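(* For a positive integer $n$, let $\overline{\mathcal{M}}_e(n)$ (resp. $\overline{\mathcal{M}}_o(n)$) be the number of overpartitions of $n$ with an even (resp. odd) number of missing integers. Then for every positive integer $n$, \[ \overline{\mathcal{M}}_e(n)-\overline{\mathcal{M}}_o(n)\equiv \begin{cases} 0 \pmod 4, & \text{if } n \text{ is not a square},\\ 2 \pmod 4, & \text{if } n \text{ is a square}. \end{cases} \]
   Context: An overpartition of $n$ is a partition of $n$ in which the first occurrence of any integer may be overlined. The largest part is the largest integer occurring (overlined or not). A missing integer is a positive integer less than the largest part that occurs neither overlined nor non-overlined. *)

(* Defs.v *)
From mathcomp Require Import all_boot.

Set Implicit Arguments.
Unset Strict Implicit.
Unset Printing Implicit Defensive.

(* A part is a pair (k, b): the integer k, overlined exactly when b = true.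
   The parts are listed in nonincreasing order; the pairwise condition says
   that a part equal (as an integer) to an earlier one is not overlined, so
   only the first occurrence of an integer may be overlined. *)
Definition is_overpartition (n : nat) (s : seq (nat * bool)) : bool :=
  [&& sorted geq (unzip1 s),
      all (fun k => 0 < k) (unzip1 s),
      sumn (unzip1 s) == n
    & pairwise (fun p q => (p.1 == q.1) ==> ~~ q.2) s].

Definition largest_part (s : seq (nat * bool)) : nat :=
  \max_(k <- unzip1 s) k.

Definition missing_integers (s : seq (nat * bool)) : seq nat :=
  [seq k <- iota 1 (largest_part s).-1 | k \notin unzip1 s].

Definition nb_missing (s : seq (nat * bool)) : nat := size (missing_integers s).

(* An overpartition of n has at most n parts, each at most n, so all of them
   live in the finite type n.-bseq ('I_n.+1 * bool); [overpartition_codeP]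
   below shows that this bound loses nothing. *)
Definition parts n (t : n.-bseq ('I_n.+1 * bool)) : seq (nat * bool) :=
  [seq (nat_of_ord p.1, p.2) | p <- t].

Definition overpartitions (n : nat) : {set n.-bseq ('I_n.+1 * bool)} :=
  [set t | is_overpartition n (parts t)].

Definition M_even (n : nat) : nat :=
  #|[set t in overpartitions n | ~~ odd (nb_missing (parts t))]|.

Definition M_odd (n : nat) : nat :=
  #|[set t in overpartitions n | odd (nb_missing (parts t))]|.

Lemma parts_inj n : injective (@parts n).
Proof.
move=> t u e; apply: val_inj; apply: inj_map e.
by move=> [i b] [j c] [] /val_inj -> ->.
Qed.

Lemma overpartition_codeP n (s : seq (nat * bool)) :
  is_overpartition n s <-> exists2 t, t \in overpartitions n & parts t = s.
Proof.
split=> [hs | [t]]; last by rewrite inE => ? <-.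
have /and4P[_ /allP hpos /eqP hsum _] := hs.
have hsz : size s <= n.
  rewrite -hsum; elim: s hpos {hs hsum} => //= p s IHs hpos.
  rewrite -add1n leq_add ?hpos ?mem_head // IHs // => k hk.
  by apply: hpos; rewrite inE hk orbT.
have hle k : k \in unzip1 s -> k <= n.
  rewrite -hsum; elim: (unzip1 s) => //= a r IHr; rewrite inE.
  case/orP=> [/eqP-> | /IHr h]; first exact: leq_addr.
  exact: leq_trans h (leq_addl _ _).
pose u := [seq (inord p.1 : 'I_n.+1, p.2) | p <- s].
have hu : size u <= n by rewrite size_map.
have e : parts (Bseq hu) = s.
  rewrite /parts /= -map_comp -[RHS]map_id; apply/eq_in_map => -[k b] hk /=.
  by rewrite inordK // ltnS hle //; apply/mapP; exists (k, b).
by exists (Bseq hu); rewrite ?inE e.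
Qed.

(* Main.v *)
Require Import Defs.
From mathcomp Require Import all_boot all_order all_algebra.
From mathcomp Require Import zify.

(** Changing whether the first occurrence of an integer is overlined does not
    change the missing integers. Doing so independently for the largest and
    the smallest part groups the overpartitions with at least two distinct
    integers into classes of four, all with the same number of missing
    integers. Modulo 4 only the overpartitions with a single integer remain:
    two for each divisor of n. As 2 = -2 modulo 4, their signs are irrelevant,
    so the difference is congruent to twice the number of divisors of n, which
    is odd exactly when n is a square. *)

(** * Involutions and the parity of the divisor count *)

(** The involution [f] exchanges the elements of [A] that satisfy [b] with those that do not. *)
Lemma card_sign_reversing (T : finType) (A : {set T}) (b : pred T) (f : T -> T) :
  {in A, forall x, f x \in A} -> {in A, forall x, f (f x) = x} ->
  {in A, forall x, b (f x) = ~~ b x} ->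
  #|A| = 2 * #|[set x in A | b x]|.
Proof.
move=> fA fK fb; rewrite -(cardsID [set x | b x] A) mul2n -addnn.
have -> : A :&: [set x | b x] = [set x in A | b x].
  by apply/setP=> x; rewrite !inE.
have -> // : #|A :\: [set x | b x]| = #|[set x in A | b x]|.
have -> : A :\: [set x | b x] = f @: [set x in A | b x].
  apply/setP=> x; rewrite !inE; apply/andP/imsetP => [[nbx xA]|[y]].
    by exists (f x); rewrite ?inE ?fK // fA //= fb.
  by rewrite inE => /andP[yA yb] ->; rewrite fA // fb // yb.
apply: card_in_imset => x y; rewrite !inE => /andP[xA _] /andP[yA _] e.
by rewrite -(fK x xA) e fK.
Qed.

(** The involution sending [d] to [n %/ d] pairs the divisors with [d * d < n] with those with
    [d * d > n]. Only a square root of [n] is fixed, and there is at most one. *)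
Lemma odd_card_dvdn (n : nat) : 0 < n ->
  reflect (exists m, n = m ^ 2) (odd #|[set d : 'I_n.+1 | d %| n]|).
Proof.
move=> n_gt0; set D := [set d : 'I_n.+1 | d %| n].
rewrite -(cardsID [set d : 'I_n.+1 | d * d == n] D).
pose f (d : 'I_n.+1) : 'I_n.+1 := inord (n %/ d).
have fE d : f d = n %/ d :> nat by rewrite inordK // ltnS leq_div.
have -> : #|D :\: [set d : 'I_n.+1 | d * d == n]|
    = 2 * #|[set d in D :\: [set d : 'I_n.+1 | d * d == n] | d * d < n]|.
  apply: (@card_sign_reversing _ _ _ f) => d; rewrite !inE => /andP[dd] /dvdnP[k kE];
    have /andP[k_gt0 d_gt0] : (0 < k) && (0 < d) by [rewrite -muln_gt0 -kE];
    have qE : n %/ d = k := etrans (congr1 (divn^~ d) kE) (mulnK k d_gt0).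
  - rewrite fE qE; apply/andP; split; last by apply/dvdnP; exists d; rewrite mulnC.
    by apply: contraNneq dd => e; nia.
  - apply: val_inj; rewrite /= !fE qE.
    exact: etrans (congr1 (divn^~ k) kE) (mulKn d k_gt0).
  - by rewrite fE qE; apply/idP/idP; nia.
rewrite oddD oddM addbF; apply: (iffP idP) => [h | [m mE]].
  have /card_gt0P[d] : 0 < #|D :&: [set d : 'I_n.+1 | d * d == n]|.
    by case: #|_| h.
  by rewrite !inE => /andP[_ /eqP <-]; exists d; rewrite -mulnn.
have m_lt : m < n.+1 by rewrite mE; nia.
have -> : D :&: [set d : 'I_n.+1 | d * d == n] = [set Ordinal m_lt].
  apply/setP=> d; rewrite !inE; apply/andP/eqP => [[_ /eqP dE]|->].
    by apply: val_inj => /=; nia.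
  by rewrite /= mE -mulnn dvdn_mulr.
by rewrite cards1.
Qed.

(** * Toggling the overline on an integer *)

Fixpoint toggle (k : nat) (s : seq (nat * bool)) : seq (nat * bool) :=
  if s is p :: s' then
    if p.1 == k then (p.1, ~~ p.2) :: s' else p :: toggle k s'
  else [::].

Lemma unzip1_toggle k s : unzip1 (toggle k s) = unzip1 s.
Proof. by elim: s => //= p s IHs; case: ifP => //= _; rewrite IHs. Qed.

Lemma toggleK k : involutive (toggle k).
Proof.
elim=> //= -[i b] s IHs /=; case: ifP => /= e; rewrite e ?negbK //.
by rewrite IHs.
Qed.

Lemma nb_missing_toggle k s : nb_missing (toggle k s) = nb_missing s.
Proof.
by rewrite /nb_missing /missing_integers /largest_part unzip1_toggle.
Qed.

(** The pairwise condition restricts overlines only on repeated occurrences, and [toggle] changes a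
    first occurrence. *)
Lemma is_overpartition_toggle n k s :
  is_overpartition n (toggle k s) = is_overpartition n s.
Proof.
rewrite /is_overpartition unzip1_toggle; do 3 congr (_ && _).
elim: s => //= -[i b] s IHs; case: ifP => //= e; rewrite IHs.
congr (_ && _); elim: s {IHs} => //= -[j c] s IHs.
case: ifP => //= ej; rewrite ?IHs //.
by rewrite (eqP ej) e.
Qed.

Lemma mem_toggle_neq j k s : j != k ->
  ((j, true) \in toggle k s) = ((j, true) \in s).
Proof.
move=> njk; elim: s => //= -[i b] s IHs.
case: ifP => /= e; rewrite !inE ?IHs //.
by rewrite !xpair_eqE (eqP e) (negPf njk).
Qed.

(** Later copies of [k] are never overlined, so the toggled entry alone decides membership. *)
Lemma mem_toggle n k s : is_overpartition n s -> k \in unzip1 s ->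
  ((k, true) \in toggle k s) = ~~ ((k, true) \in s).
Proof.
case/and4P=> _ _ _; elim: s => //= -[i b] s IHs /= /andP[/allP his hs].
rewrite !inE eq_sym; case: eqVneq => /= [<- _ | nik].
  rewrite inE.
  have /negPf-> : (i, true) \notin s.
    by apply/negP => /his /=; rewrite eqxx.
  by rewrite !xpair_eqE eqxx /=; case: b {his}.
by move=> hk; rewrite inE IHs // !xpair_eqE eq_sym (negPf nik).
Qed.

(** * Halving counts by a toggle *)

Definition overpartitions_with (n : nat) (P : pred (seq (nat * bool))) :=
  [set t in overpartitions n | P (parts t)].

(** An inverse of [parts], used to carry maps on lists over to the finite type. The default is
    reached only outside the image of [parts]. *)
Definition encode (n : nat) (s : seq (nat * bool)) : n.-bseq ('I_n.+1 * bool) :=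
  odflt [bseq] [pick t | parts t == s].

Lemma encodeK n s : is_overpartition n s -> parts (encode n s) = s.
Proof.
move=> /overpartition_codeP[t _ <-]; rewrite /encode.
by case: pickP => [u /eqP // | /(_ t)]; rewrite eqxx.
Qed.

(** The choice [k] depends only on the underlying integers, which toggling preserves. The same
    integer is therefore toggled back, and the map is an involution. *)
Lemma card_overpartitions_toggle n (P b : pred (seq (nat * bool)))
    (k : seq nat -> nat) :
  (forall s, is_overpartition n s -> P s ->
     let s' := toggle (k (unzip1 s)) s in P s' /\ b s' = ~~ b s) ->
  #|overpartitions_with n P| = 2 * #|overpartitions_with n (predI P b)|.
Proof.
move=> h; pose F s := toggle (k (unzip1 s)) s.
have FK s : F (F s) = s by rewrite /F unzip1_toggle toggleK.
have Fop s : is_overpartition n (F s) = is_overpartition n s.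
  exact: is_overpartition_toggle.
pose f (t : n.-bseq ('I_n.+1 * bool)) := encode n (F (parts t)).
have -> : overpartitions_with n (predI P b)
    = [set t in overpartitions_with n P | b (parts t)].
  by apply/setP=> t; rewrite !inE /= andbA.
have fE t : is_overpartition n (parts t) -> parts (f t) = F (parts t).
  by move=> ht; rewrite encodeK ?Fop.
apply: (@card_sign_reversing _ _ _ f) => t; rewrite !inE => /andP[ht hP];
  have [hP' hb] := h _ ht hP.
- by rewrite fE // Fop ht.
- by apply: parts_inj; rewrite !fE ?Fop ?FK.
- by rewrite fE.
Qed.

(** * Toggles at the largest and the smallest integer *)

Definition largest_key (s : seq (nat * bool)) := head 0 (unzip1 s).
Definition smallest_key (s : seq (nat * bool)) := last 0 (unzip1 s).

Definition single (s : seq (nat * bool)) := largest_key s == smallest_key s.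
Definition largest_overlined (s : seq (nat * bool)) := (largest_key s, true) \in s.
Definition smallest_overlined (s : seq (nat * bool)) := (smallest_key s, true) \in s.

Section PositiveWeight.

Variable n : nat.
Hypothesis n_gt0 : 0 < n.

Lemma largest_key_mem s : is_overpartition n s -> largest_key s \in unzip1 s.
Proof.
case/and4P=> _ _; rewrite /largest_key; case: s => [/eqP e|p s _ _].
  by move: n_gt0; rewrite -e.
exact: mem_head.
Qed.

Lemma smallest_key_mem s : is_overpartition n s -> smallest_key s \in unzip1 s.
Proof.
case/and4P=> _ _; rewrite /smallest_key; case: s => [/eqP e|p s _ _].
  by move: n_gt0; rewrite -e.
exact: mem_last.
Qed.

(** Toggling the largest integer gives the first factor 2. Where the smallest integer differs from
    it, toggling the smallest keeps the largest overlined and gives a second factor 2. *)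
Lemma card_overpartitions_mod4 (P : pred (seq (nat * bool))) :
  (forall k s, P (toggle k s) = P s) ->
  exists x, #|overpartitions_with n P| =
    2 * #|overpartitions_with n [pred s | [&& P s, single s & largest_overlined s]]|
    + 4 * x.
Proof.
move=> PT.
have singleT k s : single (toggle k s) = single s.
  by rewrite /single /largest_key /smallest_key unzip1_toggle.
rewrite (@card_overpartitions_toggle n P largest_overlined (head 0)); last first.
  move=> s hs hP; split; first by rewrite PT.
  rewrite /largest_overlined {1}/largest_key unzip1_toggle.
  by rewrite (mem_toggle _ _ _ hs) // largest_key_mem.
pose Q := predI (predI P largest_overlined) (predC single).
(* One representative per class of four: largest and smallest integers distinct and both
   overlined. *)
exists #|overpartitions_with n (predI Q smallest_overlined)|.
rewrite (_ : 4 = 2 * 2) // -mulnA -mulnDr; congr (2 * _).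
rewrite -(@card_overpartitions_toggle n Q smallest_overlined (last 0)); last first.
  move=> s hs /andP[/andP[/= hP hl] hns]; split.
    rewrite /= PT hP singleT hns andbT /=.
    rewrite /largest_overlined /largest_key unzip1_toggle.
    by rewrite mem_toggle_neq.
  rewrite /smallest_overlined {1}/smallest_key unzip1_toggle.
  by rewrite (mem_toggle _ _ _ hs) // smallest_key_mem.
rewrite -(cardsID [set t : n.-bseq _ | single (parts t)]
                  (overpartitions_with n (predI P largest_overlined))).
congr (_ + _); apply: eq_card => t; rewrite !inE /= ?[RHS]andbA.
- by case: (is_overpartition _ _) (P _) (single _) (largest_overlined _) => -[] [] [].
- by rewrite andbC !andbA.
Qed.

(** * Overpartitions with a single integer *)

Definition rectangle (d : nat) : seq (nat * bool) :=
  (d, true) :: nseq (n %/ d).-1 (d, false).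

Lemma is_overpartition_rectangle d : d %| n -> is_overpartition n (rectangle d).
Proof.
case/dvdnP=> m mE; have d_gt0 : 0 < d by nia.
have m_gt0 : 0 < m by nia.
rewrite /rectangle mE mulnK // /is_overpartition /= /unzip1 map_nseq /=.
apply/and4P; split.
- by elim: m.-1 => //= k IHk; rewrite /geq /= leqnn.
- by rewrite d_gt0 all_nseq d_gt0 orbT.
- by rewrite sumn_nseq; apply/eqP; nia.
- rewrite all_nseq /= eqxx orbT /=.
  by elim: m.-1 => //= k IHk; rewrite IHk andbT all_nseq /= implybT orbT.
Qed.

Lemma single_rectangle d : single (rectangle d).
Proof.
rewrite /single /largest_key /smallest_key /= /unzip1 map_nseq.
by elim: _.-1 => //= k /eqP <-.
Qed.

(** A nonincreasing list whose first and last entries agree is constant, and only its first entry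
    can carry the overline. *)
Lemma single_overlinedE s :
  is_overpartition n s -> single s -> largest_overlined s ->
  largest_key s %| n /\ s = rectangle (largest_key s).
Proof.
rewrite /single /largest_overlined /smallest_key /largest_key.
case: s => [|[d b] s]; first by case/and4P=> _ _ /eqP e; move: n_gt0; rewrite -e.
case/and4P=> /= hsort /andP[d_gt0 _] hsum /andP[/allP hd _] /eqP hdl hm.
have bT : b.
  move: hm; rewrite inE => /predU1P[[] // | /hd /=]; by rewrite eqxx.
have keys : all (pred1 d) (unzip1 s).
  apply/allP=> k ks; rewrite /= eqn_leq; apply/andP; split.
    have := order_path_min (rev_trans leq_trans) hsort.
    by move/allP/(_ k ks).
  (* For [d <= k], cut the list just after an occurrence of [k]: the last entry, equal to [d], is
     [k] or comes after it. *)
  rewrite hdl; case/splitPl: (mem_behead (s := d :: unzip1 s) ks : k \in d :: unzip1 s) hsort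
    => p1 p2 lp; rewrite cat_path last_cat lp => /andP[_ hp].
  have := order_path_min (rev_trans leq_trans) hp.
  by case: (lastP p2) {hp} => // p x; rewrite last_rcons all_rcons => /andP[].
have sE : s = nseq (size s) (d, false).
  apply/all_pred1P/allP => -[k c] ks /=.
  have /eqP kd : k == d by apply: (allP keys); apply/mapP; exists (k, c).
  by have := hd _ ks; rewrite /= kd eqxx /= xpair_eqE eqxx /=; case: c {ks}.
have nE : n = (size s).+1 * d.
  by rewrite -(eqP hsum) sE /unzip1 map_nseq sumn_nseq size_nseq mulSn mulnC.
split; first by rewrite nE dvdn_mull.
by rewrite /rectangle bT nE mulnK //= -sE.
Qed.

(** Divisors correspond to these overpartitions through [rectangle], with inverse [largest_key]. *)
Lemma card_single_overlined :
  #|overpartitions_with n (predI single largest_overlined)|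
  = #|[set d : 'I_n.+1 | d %| n]|.
Proof.
have -> : overpartitions_with n (predI single largest_overlined)
    = [set encode n (rectangle d) | d : 'I_n.+1 in [set d : 'I_n.+1 | d %| n]].
  apply/setP=> t; rewrite !inE; apply/and3P/imsetP => [[ht hs hl]|[d]].
    have [hd htE] := single_overlinedE _ ht hs hl.
    have d_lt : largest_key (parts t) < n.+1 by rewrite ltnS dvdn_leq.
    exists (Ordinal d_lt); first by rewrite inE.
    by apply: parts_inj; rewrite encodeK // is_overpartition_rectangle.
  rewrite inE => hd ->; rewrite encodeK ?is_overpartition_rectangle //.
  by rewrite single_rectangle /largest_overlined mem_head.
apply: card_in_imset => d e; rewrite !inE => hd he /(congr1 (@parts n)).
by rewrite !encodeK ?is_overpartition_rectangle // => -[/val_inj].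
Qed.

End PositiveWeight.

Theorem theorem3p7 (n : nat) (n_gt0 : (0 < n)%N) :
  ((~ exists m : nat, n = (m ^ 2)%N) ->
     (((M_even n)%:Z - (M_odd n)%:Z)%R = 0%:Z %[mod 4%:Z])%Z)
  /\
  ((exists m : nat, n = (m ^ 2)%N) ->
     (((M_even n)%:Z - (M_odd n)%:Z)%R = 2%:Z %[mod 4%:Z])%Z).
Proof.
pose odd_missing s := odd (nb_missing s).
have [|x xE] := @card_overpartitions_mod4 n n_gt0 (predC odd_missing).
  by move=> k s; rewrite /= /odd_missing nb_missing_toggle.
have [|y yE] := @card_overpartitions_mod4 n n_gt0 odd_missing.
  by move=> k s; rewrite /odd_missing nb_missing_toggle.
have evenE : M_even n = #|overpartitions_with n (predC odd_missing)| by [].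
have oddE : M_odd n = #|overpartitions_with n odd_missing| by [].
have := card_single_overlined n n_gt0.
(* The divisor count splits as [a + b] by the parity of the number of missing integers. *)
rewrite -(cardsID [set t : n.-bseq _ | odd_missing (parts t)]) => DE.
have {}DE : #|overpartitions_with n
      [pred s | [&& odd_missing s, single s & largest_overlined s]]|
    + #|overpartitions_with n
      [pred s | [&& predC odd_missing s, single s & largest_overlined s]]|
    = #|[set d : 'I_n.+1 | d %| n]|.
  rewrite -DE; congr (_ + _); apply: eq_card => t; rewrite !inE /=.
    by rewrite andbA [RHS]andbC andbA [_ && odd_missing _]andbC -!andbA.
  by rewrite andbCA.
have sq := odd_card_dvdn n n_gt0.
(* With [b] the even and [a] the odd class, the difference is [2 * (b - a)] modulo 4, hence
   [2 * (a + b)], twice the divisor count. *)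
split=> hn; move: DE xE yE; rewrite -evenE -oddE => DE xE yE.
  have /negP : ~ odd #|[set d : 'I_n.+1 | d %| n]| by move/sq.
  by lia.
have : odd #|[set d : 'I_n.+1 | d %| n]| by apply/sq.
by lia.
Qed.
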